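(* Let $n,f,k$ be integers with $0\le f<n$ and $k\ge 1$. In an asynchronous system with $n$ processes, up to $f$ of which may be initially dead, $k$-set agreement is solvable if and only if $kn>(k+1)f$ or, equivalently, $$k>\frac{f}{n-f}.$$
   Context: Processes and runs. $\Pi=\{p_1,\dots,p_n\}$ is a set of $n$ processes with unique ids $1,\dots,n$ communicating by message passing, with messages from a (possibly infinite) universe $M$. Each process has a message buffer containing the messages sent to it but not yet received. Each process $p$ is a deterministic state machine whose local state contains an input (proposal) value $x_p$ from a finite set $V$ with $|V|\ge n$, and a write-once output (decision) value $y_p\in V\cup\{\bot\}$, initially $\bot\notin V$; all other components are initialized to fixed values. In a step, a process atomically takes its current local state and a (possibly empty) subset $L$ of the messages in its buffer and moves to a new local state according to the transition relation; a deterministic message sending function maps the current state and $L$ to a subset of $\Pi\times M$, and each $(q,m)$ in it is sent by placing $m$ in $q$'s buffer. A configuration is the vector of local states together with all message buffers; initially all processes are in initial states and all buffers are empty. A run is an infinite sequence of configurations starting from an initial configuration, each resulting from the previous one by a legitimate step of a single process. Asynchronous system with initially dead processes. Admissible runs are those in which at most $f$ processes are faulty, the faulty processes are initially dead (they take no step at all), every other (correct) process takes infinitely many steps, and every message sent to a correct process is eventually received. There are no bounds on relative process speeds or message delays, and there is no failure detector. $k$-set agreement. An algorithm solves $k$-set agreement if in all its admissible runs: ($k$-Agreement) processes decide on at most $k$ different values; (Validity) if a process decides on $v$, then $v$ was proposed by some process; (Termination) every correct process eventually decides, i.e. irrevocably sets its output. The problem is solvable if some algorithm solves it. *)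

(* Defs.v *)
From mathcomp Require Import all_boot all_order all_algebra.
From mathcomp Require Import boolp classical_sets.

Set Implicit Arguments.
Unset Strict Implicit.
Unset Printing Implicit Defensive.

Local Open Scope classical_set_scope.

(* Processes are the elements of 'I_n, V is the set of proposal values, and
   the undecided output is None.  Apart from input and output, the local state
   consists of an arbitrary component [memory]. *)
Record local_state (V mem : Type) := LocalState {
  input : V;
  output : option V;
  memory : mem }.

(* The message universe and the memory type are chosen by the algorithm and
   may be infinite.  Transition and sending functions may depend on the process
   id; neither is required to be computable. *)
Record algorithm (n : nat) (V : finType) := Algorithm {
  msg : Type;
  mem : Type;
  mem0 : 'I_n -> mem;
  trans : 'I_n -> local_state V mem -> set msg -> local_state V mem;
  send : 'I_n -> local_state V mem -> set msg -> set ('I_n * msg);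
  write_once : forall p s L v,
    output s = Some v -> output (trans p s L) = Some v }.

Section Runs.
Variables (n : nat) (V : finType) (A : algorithm n V).

Record config := Config {
  state : 'I_n -> local_state V (mem A);
  buffer : 'I_n -> set (msg A) }.

Definition initial (C : config) : Prop :=
  forall p, [/\ output (state C p) = None,
                memory (state C p) = mem0 A p &
                buffer C p = set0].

Definition step (p : 'I_n) (L : set (msg A)) (C C' : config) : Prop :=
  [/\ L `<=` buffer C p,
      forall q, state C' q =
        if q == p then trans p (state C p) L else state C q &
      forall q, buffer C' q =
        (if q == p then buffer C q `\` L else buffer C q)
        `|` [set m | send p (state C p) L (q, m)]].

(* A step may leave the configuration unchanged, so the configurations alone do
   not determine who stepped and what was received: the t-th step, from
   [conf t] to [conf t.+1], is recorded by [actor t] and [received t]. *)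
Record run := Run {
  conf : nat -> config;
  actor : nat -> 'I_n;
  received : nat -> set (msg A);
  run_initial : initial (conf 0);
  run_step : forall t, step (actor t) (received t) (conf t) (conf t.+1) }.

Implicit Type r : run.

Definition initially_dead r : {set 'I_n} :=
  [set p | `[< forall t, actor r t <> p >]]%SET.

Definition correct r (p : 'I_n) : Prop := p \notin initially_dead r.

Definition sent r (t : nat) (q : 'I_n) (m : msg A) : Prop :=
  send (actor r t) (state (conf r t) (actor r t)) (received r t) (q, m).

Definition admissible (f : nat) r : Prop :=
  [/\ #|initially_dead r| <= f,
      forall p, correct r p -> forall t, exists2 t', t <= t' & actor r t' = p &
      forall q, correct r q -> forall t m, sent r t q m ->
        exists t', [/\ t < t', actor r t' = q & received r t' m]].

Definition decides r (p : 'I_n) (v : V) : Prop :=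
  exists t, output (state (conf r t) p) = Some v.

Definition proposes r (p : 'I_n) (v : V) : Prop :=
  input (state (conf r 0) p) = v.

Definition k_agreement (k : nat) r : Prop :=
  #|[set v : V | `[< exists p, decides r p v >]]%SET| <= k.

Definition validity r : Prop :=
  forall p v, decides r p v -> exists q, proposes r q v.

(* Irrevocability of decisions is the field [write_once]. *)
Definition termination r : Prop :=
  forall p, correct r p -> exists v, decides r p v.

Definition solves_set_agreement (f k : nat) : Prop :=
  forall r, admissible f r -> [/\ k_agreement k r, validity r & termination r].

End Runs.

Definition set_agreement_solvable (n f k : nat) (V : finType) : Prop :=
  exists A : algorithm n V, solves_set_agreement A f k.

(* Main.v *)
Require Import Defs.
From mathcomp Require Import all_boot all_order all_algebra.
From mathcomp Require Import boolp classical_sets.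
Import GRing.Theory Num.Theory.

(* Put m = n - f; the condition says n < (k + 1) m.

   If (k + 1) m <= n, there are k + 1 disjoint groups of m processes.  A group
   whose complement is dead decides, and it decides the proposal of one of its
   own members, because the inputs of the dead processes are irrelevant.  With
   distinct inputs, the solo executions of the groups can be performed one after
   the other, delaying all other messages until the end: k + 1 values are
   decided in a run without faulty processes.

   If n < (k + 1) m, the protocol generalises that of Fischer, Lynch and
   Paterson for initially dead processes.  Every process fixes as its view a set
   of at least m processes it has heard from, and announces it.  Views define a
   graph, and a process that knows the views of all its ancestors picks an
   ancestor q whose own set of ancestors is minimal, and decides the proposal of
   a representative of this set.  Minimal ancestor sets are pairwise disjoint and
   have at least m elements, so there are at most k of them. *)

Set Implicit Arguments.
Unset Strict Implicit.
Unset Printing Implicit Defensive.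

Local Open Scope nat_scope.
Local Open Scope classical_set_scope.

(** * Finite executions and their transfer between configurations *)

Section Executions.
Variables (n : nat) (V : finType) (A : algorithm n V).
Implicit Types (C : config A) (e : 'I_n * set (msg A)) (D : {set 'I_n}).
Implicit Types (s : seq ('I_n * set (msg A))).

Definition exec1 C e : config A := Config
  (fun q => if q == e.1 then trans e.1 (state C e.1) e.2 else state C q)
  (fun q => (if q == e.1 then buffer C q `\` e.2 else buffer C q)
            `|` [set m | send e.1 (state C e.1) e.2 (q, m)]).

Definition exec C s := foldl exec1 C s.

Lemma exec_cat C s1 s2 : exec C (s1 ++ s2) = exec (exec C s1) s2.
Proof. exact: foldl_cat. Qed.

Fixpoint legal C s : Prop :=
  if s is e :: s' then e.2 `<=` buffer C e.1 /\ legal (exec1 C e) s' else True.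

Lemma exec1_step C e : e.2 `<=` buffer C e.1 -> step e.1 e.2 C (exec1 C e).
Proof. by []. Qed.

Lemma legal_cat C s1 s2 :
  legal C s1 -> legal (exec C s1) s2 -> legal C (s1 ++ s2).
Proof. by elim: s1 C => //= e s1 IH C [? ?] ?; split=> //; apply: IH. Qed.

Lemma legal_nth C s e0 t : legal C s -> t < size s ->
  (nth e0 s t).2 `<=` buffer (exec C (take t s)) (nth e0 s t).1.
Proof.
elim: s C t => //= e s IH C [|t] [He Hs] //= ht.
exact: IH.
Qed.

Definition within D s := all (fun e => e.1 \in D) s.

(** Buffers are compared by inclusion only, as other processes may have sent extra messages; a
    schedule fixes what is received, so these do no harm. *)
Definition simulates D C C' := forall p, p \in D ->
  state C' p = state C p /\ buffer C p `<=` buffer C' p.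

Lemma exec1_simulates D C C' e : e.1 \in D ->
  simulates D C C' -> simulates D (exec1 C e) (exec1 C' e).
Proof.
move=> eD CC' p pD; have [sp bp] := CC' p pD; have [se be] := CC' _ eD.
split=> /=; first by rewrite sp se.
rewrite se; apply: setSU; case: ifP => // _; exact: setSD.
Qed.

Lemma exec_simulates D C C' s : within D s -> legal C s ->
  simulates D C C' -> legal C' s /\ simulates D (exec C s) (exec C' s).
Proof.
elim: s C C' => //= e s IH C C' /andP[eD sD] [He Hs] CC'.
have [] := IH _ _ sD Hs (exec1_simulates eD CC').
split=> //; split=> //; apply: (subset_trans He).
by have [] := CC' _ eD.
Qed.

(** Processes outside [D'] act on [D'] only by adding messages to its buffers. *)
Lemma exec_frame D D' C s : within D s -> {in D', forall p, p \notin D} ->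
  simulates D' C (exec C s).
Proof.
move=> sD dis; elim: s C sD => [|e s IH] C /= => [_ p _|/andP[eD sD] p pD].
  by split.
have [-> sub] := IH (exec1 C e) sD p pD.
have pe : (p == e.1) = false.
  by apply/eqP => pe; move: (dis p pD); rewrite pe eD.
split=> /=; first by rewrite pe.
by apply: subset_trans sub => /= m; rewrite pe; left.
Qed.

Definition start (x : 'I_n -> V) : config A :=
  Config (fun p => LocalState (x p) None (mem0 A p)) (fun=> set0).

Lemma start_initial x : initial (start x). Proof. by []. Qed.

(** * Extending a finite execution to an admissible run *)

Section Extension.
Variables (D : {set 'I_n}) (p0 : 'I_n) (x : 'I_n -> V).
Variable s : seq ('I_n * set (msg A)).
Hypotheses (p0D : p0 \in D) (sD : within D s) (sl : legal (start x) s).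

Definition round_robin t := nth p0 (enum D) (t %% #|D|).

(** After the script [s], the members of [D] take turns and each empties its buffer, which gives
    fairness and delivery at once. *)
Definition event_at t C :=
  if t < size s then nth (p0, set0) s t
  else (round_robin t, buffer C (round_robin t)).

Fixpoint ext_conf t :=
  if t is t'.+1 then exec1 (ext_conf t') (event_at t' (ext_conf t'))
  else start x.

Lemma ext_conf_prefix t : t <= size s -> ext_conf t = exec (start x) (take t s).
Proof.
elim: t => [|t IH] ht /=; first by rewrite take0.
rewrite IH ?(ltnW ht)// (take_nth (p0, set0))// /exec foldl_rcons.
by rewrite /event_at ht.
Qed.

Lemma ext_step t : step (event_at t (ext_conf t)).1 (event_at t (ext_conf t)).2
  (ext_conf t) (ext_conf t.+1).
Proof.
apply: exec1_step; rewrite /event_at; case: ifP => [ht|_]; last by move=> m.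
by rewrite ext_conf_prefix ?(ltnW ht)//; apply: legal_nth.
Qed.

Definition ext_run : run A := Run (start_initial x) ext_step.

Lemma D_gt0 : 0 < #|D|. Proof. by apply/card_gt0P; exists p0. Qed.

Lemma round_robinP t : round_robin t \in D.
Proof.
by rewrite -mem_enum mem_nth// -cardE ltn_mod D_gt0.
Qed.

Lemma ext_actor t : actor ext_run t \in D.
Proof.
rewrite /= /event_at; case: ifP => ht; last exact: round_robinP.
by move/allP: sD; apply; apply: mem_nth.
Qed.

Lemma ext_fair p t : p \in D -> exists t',
  [/\ t <= t', actor ext_run t' = p &
      received ext_run t' = buffer (conf ext_run t') p].
Proof.
(* A multiple of [#|D|] plus the index of [p] is a turn of [p]; as [#|D|] is positive, the multiple
   is at least [t + size s], hence past the script. *)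
move=> pD; exists ((t + size s) * #|D| + index p (enum D)).
have D0 := D_gt0.
have le : t + size s <= (t + size s) * #|D| by apply: leq_pmulr.
have -> /= : t <= (t + size s) * #|D| + index p (enum D).
  apply: leq_trans (leq_addr _ _); apply: leq_trans le; exact: leq_addr.
rewrite /event_at ltnNge (_ : size s <= _) /=; last first.
  apply: leq_trans (leq_addr _ _); apply: leq_trans le; exact: leq_addl.
have ip : index p (enum D) < #|D| by rewrite cardE index_mem mem_enum.
by rewrite /round_robin modnMDl modn_small// nth_index// mem_enum.
Qed.


Lemma correct_ext p : correct ext_run p <-> p \in D.
Proof.
rewrite /correct inE; split.
  apply: contraR => pD; apply/asboolP => t tp.
  by move/negP: pD; apply; rewrite -tp ext_actor.
move=> /(ext_fair 0)[t [_ tp _]]; apply/negP => /asboolP /(_ t); exact.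
Qed.

Lemma ext_delivery q t m : q \in D -> m \in buffer (conf ext_run t) q ->
  exists t', [/\ t <= t', actor ext_run t' = q & m \in received ext_run t'].
Proof.
move=> qD; rewrite inE => mt; have [t' [tt' qt' rt']] := ext_fair t qD.
have [mt'|//] : m \in buffer (conf ext_run t') q \/ exists t',
    [/\ t <= t', actor ext_run t' = q & m \in received ext_run t'].
  elim: t' tt' {qt' rt'} => [|t' IH].
    by rewrite leqn0 => /eqP t0; left; rewrite inE -t0.
  rewrite leq_eqVlt => /predU1P[<-|/[!ltnS] /[dup] tt' /IH]; first by left; rewrite inE.
  case=> [mt'|]; last by right.
  have [mr|mr] := pselect (actor ext_run t' = q /\ m \in received ext_run t').
    by right; exists t'; case: mr.
  left; rewrite inE /=; left; rewrite inE in mt'.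
  case: ifP => // /eqP qe; split=> // mr'; apply: mr.
  by split=> //; rewrite inE.
by exists t'; split=> //; rewrite rt'.
Qed.

Lemma ext_admissible f : n <= f + #|D| -> admissible f ext_run.
Proof.
move=> nf; split.
- have : initially_dead ext_run \subset (~: D)%SET.
    apply/fintype.subsetP => p; rewrite finset.in_setC => pd.
    by apply/negP => /correct_ext; rewrite /correct pd.
  move=> /subset_leq_card /leq_trans; apply.
  by rewrite -(leq_add2r #|D|) addnC cardsC card_ord.
- by move=> p /correct_ext /ext_fair pf t; have [t' [tt' tp _]] := pf t; exists t'.
- move=> q /correct_ext qD t m st.
  have [|t' [tt' tq mr]] := @ext_delivery q t.+1 m qD; first by rewrite inE; right.
  by exists t'; split=> //; rewrite -inE.
Qed.

(** Turns an initial piece of the infinite run back into a schedule that can be replayed from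
    another configuration. *)
Definition ext_prefix t := [seq event_at i (ext_conf i) | i <- iota 0 t].

Lemma ext_prefixP t : [/\ within D (ext_prefix t), legal (start x) (ext_prefix t)
  & exec (start x) (ext_prefix t) = ext_conf t].
Proof.
elim: t => [|t [tD tl te]] //.
rewrite /ext_prefix -addn1 iotaD map_cat add0n -/(ext_prefix t); split.
- by rewrite /within all_cat -/(within D _) tD /= andbT; exact: (ext_actor t).
- apply: legal_cat => //=; rewrite te; split=> //.
  by have [] := ext_step t.
- by rewrite exec_cat te addn1.
Qed.

End Extension.

(** * Impossibility from disjoint groups *)

Lemma group_decides f k D p0 (x : 'I_n -> V) :
  solves_set_agreement A f k -> p0 \in D -> n <= f + #|D| ->
  exists s p q, [/\ within D s, legal (start x) s, p \in D, q \in D &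
    output (state (exec (start x) s) p) = Some (x q)].
Proof.
move=> sol p0D nf.
(* The dead processes propose the value of [p0], so by validity the group
   decides a value of its own. *)
pose x' q := if q \in D then x q else x p0.
have sD0 : within D (Nil ('I_n * set (msg A))) by [].
have sl0 : legal (start x') [::] by [].
have [_ val] := sol _ (ext_admissible p0D sD0 sl0 nf).
case/(_ p0); first exact/correct_ext.
move=> v pv; have [q xq] := val _ _ pv; case: pv => t pv.
have [tD tl te] := ext_prefixP p0D sD0 sl0 t.
have sim : simulates D (start x') (start x).
  by move=> p pD; split=> //=; rewrite /x' pD.
have [tl' sim'] := exec_simulates tD tl sim.
(* A proposer outside [D] proposes [x p0] under [x'], so [p0] can replace it. *)
exists (ext_prefix D p0 x' [::] t), p0, (if q \in D then q else p0); split=> //.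
  by case: ifP.
have [-> _] := sim' _ p0D; rewrite te; move: pv xq; rewrite /proposes /= => -> <-.
by rewrite /x'; case: ifP.
Qed.

(** The groups are disjoint, so the schedule of one only adds messages to the buffers of the others
    and cannot disturb their schedules. *)
Lemma concat_simulates (I : eqType) (x : 'I_n -> V) (G : I -> {set 'I_n})
    (s : I -> seq ('I_n * set (msg A))) (l : seq I) C :
  (forall i j p, p \in G i -> p \in G j -> i = j) ->
  (forall i, within (G i) (s i) /\ legal (start x) (s i)) ->
  uniq l -> (forall i, i \in l -> simulates (G i) (start x) C) ->
  legal C (flatten (map s l)) /\
  forall i, i \in l ->
    simulates (G i) (exec (start x) (s i)) (exec C (flatten (map s l))).
Proof.
move=> dis sP; elim: l C => //= i l IH C /andP[il ul] sim.
have [wi li] := sP i.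
have [lC simC] := exec_simulates wi li (sim i (mem_head _ _)).
have fr j : j != i -> simulates (G j) C (exec C (s i)).
  move=> ji; apply: exec_frame wi _ => p pj; apply/negP => pi.
  by rewrite (dis _ _ _ pi pj) eqxx in ji.
have tr D0 C1 C2 C3 : simulates D0 C1 C2 -> simulates D0 C2 C3 -> simulates D0 C1 C3.
  move=> h1 h2 p pD; have [e1 b1] := h1 p pD; have [e2 b2] := h2 p pD.
  by split; [rewrite e2|apply: subset_trans b2].
have [|lf simf] := IH (exec C (s i)) ul.
  move=> j jl; apply: tr (fr j _); first by apply: sim; rewrite inE jl orbT.
  by apply: contraNneq il => <-.
split; first exact: legal_cat.
rewrite exec_cat => j.
rewrite inE => /predU1P[->|/simf//].
apply: (tr _ _ _ _ simC); apply: exec_frame (_ : within (~: G i)%SET _) _; last first.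
  by move=> p pi; rewrite !inE pi.
apply/allP => e /flattenP[_ /mapP[j' jl ->] ej]; rewrite inE.
have [/allP wj _] := sP j'; apply/negP => ei.
by move: il; rewrite (dis _ _ _ ei (wj _ ej)) jl.
Qed.

Lemma too_many_groups f k (x : 'I_n -> V) (G : 'I_k.+1 -> {set 'I_n}) :
  injective x -> (forall i j p, p \in G i -> p \in G j -> i = j) ->
  (forall i, (exists p, p \in G i) /\ n <= f + #|G i|) ->
  ~ solves_set_agreement A f k.
Proof.
move=> xinj dis GP sol.
have /choice[s sP] : forall i, exists s, [/\ within (G i) s, legal (start x) s &
    exists p q, [/\ p \in G i, q \in G i &
      output (state (exec (start x) s) p) = Some (x q)]].
  move=> i; have [[p pi] nf] := GP i.
  have [s [p' [q [? ? ? ? ?]]]] := group_decides x sol pi nf.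
  by exists s; split=> //; exists p', q.
have [||lf simf] := @concat_simulates _ x G s (enum 'I_k.+1) (start x) dis _ (enum_uniq _).
- by move=> i; have [] := sP i.
- by move=> i _ p _; split.
have [[p0 _] _] := GP ord0.
(* The joint schedule is continued with every process alive, so all delayed messages arrive. *)
have wT : within [set: 'I_n]%SET (flatten [seq s i | i <- enum 'I_k.+1]).
  by apply/allP => e _; rewrite inE.
have nf : n <= f + #|[set: 'I_n]%SET| by rewrite cardsT card_ord leq_addl.
have [ka _ _] := sol _ (ext_admissible (finset.in_setT p0) wT lf nf).
move: ka; rewrite /k_agreement leqNgt => /negP; apply.
have /choice[q qP] : forall i, exists q, q \in G i /\
    exists p, decides (ext_run [set: 'I_n]%SET p0 lf) p (x q).
  move=> i; have [_ _ [p [q [pi qi xq]]]] := sP i; exists q; split=> //; exists p.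
  exists (size (flatten [seq s i | i <- enum 'I_k.+1])).
  rewrite /= ext_conf_prefix// take_size.
  by have [->] := simf i (mem_enum _ _) p pi.
have xq_inj : injective (x \o q).
  move=> i j /xinj qij; apply: (dis i j (q i)); first by have [] := qP i.
  by rewrite qij; have [] := qP j.
have := card_imset [set: 'I_k.+1]%SET xq_inj; rewrite cardsT card_ord => im_k; rewrite -[leqLHS]im_k.
apply: subset_leq_card.
apply/fintype.subsetP => _ /imsetP[i _ ->]; rewrite inE; apply/asboolP.
by have [] := qP i.
Qed.
End Executions.

(** * Reachability and counting *)

(** A path from [p] only uses edges leaving vertices reachable from [p]; this serves to compare
    partial knowledge of a graph with the whole graph. *)
Lemma eq_connect_from (T : finType) (e e' : rel T) (p : T) :
  (forall y, connect e p y -> e y =1 e' y) -> connect e p =1 connect e' p.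
Proof.
move=> ee'.
have eq_path s : path e p s = path e' p s.
  elim: s p ee' => //= y s IH p ee'; rewrite (ee' p (connect0 _ _)).
  case pe: (e' p y) => //=; apply: IH => z yz; apply: (ee').
  by apply: connect_trans yz; apply: connect1; rewrite ee'// connect0.
by move=> z; apply/connectP/connectP => -[s ps ->]; exists s; rewrite // eq_path in ps *.
Qed.

Lemma eventually_forall (I : finType) (P : I -> nat -> Prop) :
  (forall i, exists T, forall t, T <= t -> P i t) ->
  exists T, forall t i, T <= t -> P i t.
Proof.
move=> /choice[T TP]; exists (\max_i T i) => t i Tt.
by apply: TP; apply: leq_trans Tt; apply: leq_bigmax.
Qed.

(** If [z] lies in a minimal set [R q], then [R z] is included in it and not smaller, hence equal.
    So minimal sets that meet coincide, and disjoint sets of at least [m] elements leave room for at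
    most [k] of them. *)
Lemma card_minimal_sets (T : finType) (R : T -> {set T}) (P : pred T) (m k : nat) :
  (forall q, q \in R q) -> (forall q z, z \in R q -> R z \subset R q) ->
  (forall q, P q -> m <= #|R q|) -> #|T| < k.+1 * m ->
  #|[set R q | q : T & P q && [forall z in R q, #|R q| <= #|R z|]]%SET| <= k.
Proof.
move=> refl tr mR; set F := [set R q | q : T & _]%SET => hk.
have Fmin B z : B \in F -> z \in B -> R z = B.
  move=> /imsetP[q /[!inE] /andP[_ /forall_inP qm] ->] zq; apply/eqP.
  by rewrite eqEcard tr//= qm.
have trF : finset.trivIset F.
  apply/finset.trivIsetP => B C BF CF; apply: contraNT => /pred0Pn[z /andP[/= zB zC]].
  by rewrite -(Fmin B z)// -(Fmin C z).
have mF : #|F| * m <= #|T|.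
  apply: leq_trans (max_card (mem (finset.cover F))); rewrite -(eqP trF).
  rewrite -sum_nat_const; apply: leq_sum => _ /imsetP[q /[!inE] /andP[Pq _] ->].
  exact: mR.
by move: (leq_ltn_trans mF hk); rewrite ltn_mul2r => /andP[].
Qed.

(** * The protocol *)

Section Protocol.
Variables (n : nat) (V : finType) (m : nat).

Definition message := ('I_n * V * option {set 'I_n})%type.

Implicit Types (h : {set message}) (a : message) (p q y z c : 'I_n).
Implicit Types (v : V) (S : {set 'I_n}).

Record knowledge := Knowledge { heard : {set message}; view : option {set 'I_n} }.

Definition senders h : {set 'I_n} := [set a.1.1 | a in h]%SET.

Definition knows h z v := [exists S : {set 'I_n}, (z, v, Some S) \in h].

Definition heard_from h : rel 'I_n := fun y z =>
  [exists v, [exists S : {set 'I_n}, ((y, v, Some S) \in h) && (z \in S)]].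

Definition ancestors h p : {set 'I_n} := [set z | connect (heard_from h) p z]%SET.

(** Knowing the fixed views of all ancestors means that no edge above [p] is missing. *)
Definition ready h p := [forall z in ancestors h p, [exists v, knows h z v]].

(** The representative [c] is a function of the chosen set alone, so processes that choose the same
    set decide the same proposal. *)
Definition decision h p : option V :=
  if ready h p then
    let q := [arg min_(q < p | q \in ancestors h p) #|ancestors h q|] in
    obind (fun c => [pick v | knows h c v]) [pick c in ancestors h q]
  else None.

Lemma mem_ancestors h p : p \in ancestors h p.
Proof. by rewrite inE connect0. Qed.

Lemma ancestors_trans h p q : q \in ancestors h p ->
  ancestors h q \subset ancestors h p.
Proof.
rewrite inE => pq; apply/fintype.subsetP => z; rewrite !inE.
exact: connect_trans.
Qed.

Lemma decisionP h p v : decision h p = Some v -> ready h p /\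
  exists q c, [/\ q \in ancestors h p,
    forall z, z \in ancestors h p -> #|ancestors h q| <= #|ancestors h z|,
    [pick c in ancestors h q] = Some c & knows h c v].
Proof.
rewrite /decision; case: ifP => // rd; case: arg_minnP => [|q qp qm].
  exact: mem_ancestors.
case cq: [pick c in _] => [c|] //=; case: pickP => // v' cv [<-].
by split=> //; exists q, c.
Qed.

Lemma ready_decision h p : ready h p -> decision h p <> None.
Proof.
move=> rd; rewrite /decision rd; case: arg_minnP => [|q qp qm].
  exact: mem_ancestors.
case: pickP => [c cq|/(_ q)]; last by rewrite mem_ancestors.
have cp : c \in ancestors h p by apply: fintype.subsetP cq; apply: ancestors_trans.
have /existsP[v cv] := forall_inP rd c cp.
by rewrite /=; case: pickP => // /(_ v); rewrite cv.
Qed.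

Definition receive (s : local_state V knowledge) (L : set message) : {set message} :=
  heard (memory s) :|: [set a | `[< L a >]]%SET.

(** A view never changes once fixed; this makes the knowledge of different observers consistent. *)
Definition protocol_trans p (s : local_state V knowledge) (L : set message) :=
  let h := receive s L in
  LocalState (input s)
    (if output s is Some v then Some v else decision h p)
    (Knowledge h
       (if view (memory s) is Some B then Some B
        else if m <= #|senders h| then Some (senders h) else None)).

(* The same message is resent at every step, so that the view of a process is
   eventually announced although it is only fixed in the course of the run. *)
Definition protocol_send p (s : local_state V knowledge) (L : set message) :
  set ('I_n * message) := [set qa | qa.2 = (p, input s, view (memory s))].

Lemma protocol_write_once p s L v :
  output s = Some v -> output (protocol_trans p s L) = Some v.
Proof. by rewrite /= => ->. Qed.

Definition protocol : algorithm n V :=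
  Algorithm (fun=> Knowledge finset.set0 None) protocol_send protocol_write_once.

(** * Safety of the protocol *)

Section ProtocolRun.
Variable r : run protocol.

Let st t p : local_state V knowledge := state (conf r t) p.
Let x p := input (st 0 p).
Let H t p := heard (memory (st t p)).
Let W t p := view (memory (st t p)).

Lemma st_step t :
  st t.+1 (actor r t) = protocol_trans (actor r t) (st t (actor r t)) (received r t).
Proof. by have [_ + _] := run_step r t; move=> /(_ (actor r t)); rewrite eqxx. Qed.

Lemma st_idle t p : p != actor r t -> st t.+1 p = st t p.
Proof. by have [_ + _] := run_step r t; move=> /(_ p) + /negPf pt; rewrite pt. Qed.

Lemma input_const t p : input (st t p) = x p.
Proof.
elim: t => // t <-; have [->|/st_idle->//] := eqVneq p (actor r t).
by rewrite st_step.
Qed.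

Lemma heard_mono t t' p : t <= t' -> H t p \subset H t' p.
Proof.
move/subnK <-; elim: (t' - t) => //= d; move/fintype.subset_trans; apply.
rewrite addSn /H; have [->|/st_idle->//] := eqVneq p (actor r (d + t)).
by rewrite st_step /= finset.subsetUl.
Qed.

Lemma view_stable t t' p S : t <= t' -> W t p = Some S -> W t' p = Some S.
Proof.
move/subnK <- => tS; elim: (t' - t) => //= d; rewrite addSn /W.
have [->|/st_idle->//] := eqVneq p (actor r (d + t)).
by rewrite st_step /= => ->.
Qed.

Lemma view_unique t t' p S S' : W t p = Some S -> W t' p = Some S' -> S = S'.
Proof.
move=> /(view_stable (leq_maxl t t')) tS /(view_stable (leq_maxr t t')).
by rewrite tS => -[].
Qed.

Lemma actor_correct t : correct r (actor r t).
Proof. by rewrite /correct inE; apply/asboolP => /(_ t). Qed.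

Definition genuine a := [/\ a.1.2 = x a.1.1, correct r a.1.1 &
  forall S, a.2 = Some S -> exists t, W t a.1.1 = Some S].

(** A sender announces its true input and current view, and it is correct because it takes a step;
    what is heard comes from a buffer. *)
Lemma all_genuine t p :
  (forall a, buffer (conf r t) p a -> genuine a) /\
  (forall a, a \in H t p -> genuine a).
Proof.
elim: t p => [|t IH] p.
  have [_ memp bufp] := run_initial r p; split=> a; first by rewrite bufp.
  by rewrite /H /st memp inE.
have [sub _ buf] := run_step r t; split=> a.
  rewrite buf => -[|]; last first.
    rewrite /= /protocol_send /= => ->.
    by split=> //=; [exact: input_const|exact: actor_correct|move=> S WS; exists t].
  by have [bt _] := IH p; case: ifP => _ => [[/bt]|/bt].
have [->|pt] := eqVneq p (actor r t); last first.
  by rewrite /H st_idle//; have [_] := IH p; apply.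
rewrite /H st_step /= !inE; have [bt ht] := IH (actor r t).
by case/orP => [/ht//|/asboolP/sub/bt].
Qed.

Lemma view_spec t p S : W t p = Some S ->
  m <= #|S| /\ forall z, z \in S -> correct r z.
Proof.
elim: t => [|t IH]; first by have [_ memp _] := run_initial r p; rewrite /W /st memp.
have [pt|pt] := eqVneq p (actor r t); last by rewrite /W st_idle.
have := fun a => (all_genuine t.+1 p).2 a; move: IH.
rewrite /W /H pt st_step /=; case: (view _) => [B|_ gen]; first by move=> IH _ /IH.
case: ifP => // mh [<-]; split=> // z /imsetP[a ah ->].
by have [] := gen a ah.
Qed.

(** The graph of all views ever fixed in the run, as opposed to the part of it that a process
    knows. *)
Definition edge : rel 'I_n := fun y z => `[< exists t S, W t y = Some S /\ z \in S >].
Definition viewed y := `[< exists t S, W t y = Some S >].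
Definition sources p : {set 'I_n} := [set z | connect edge p z]%SET.

Lemma knows_genuine t p z v : knows (H t p) z v ->
  [/\ v = x z, correct r z & viewed z].
Proof.
case/existsP => S zS; have [//= -> cz WS] := (all_genuine t p).2 _ zS.
by split=> //; apply/asboolP; have [t' tS] := WS _ erefl; exists t', S.
Qed.

(** No known edge is false because messages are genuine; none is missing because a known view is the
    only one its owner ever has. *)
Lemma ready_heard_from t p y : ready (H t p) p -> y \in ancestors (H t p) p ->
  heard_from (H t p) y =1 edge y.
Proof.
move=> rd yp z; apply/existsP/asboolP.
  move=> [v /existsP[S /andP[yS zS]]]; have [_ _ WS] := (all_genuine t p).2 _ yS.
  by have [t' tS] := WS _ erefl; exists t', S.
move=> [t' [S [tS zS]]]; have /existsP[v vy] := forall_inP rd y yp.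
exists v; apply/existsP; exists S; rewrite zS andbT.
have /existsP[S' yS] := vy; have [_ _ WS] := (all_genuine t p).2 _ yS.
by have [t'' tS'] := WS _ erefl; rewrite (view_unique tS tS').
Qed.

Lemma ready_ancestors t p y : ready (H t p) p -> y \in ancestors (H t p) p ->
  ancestors (H t p) y = sources y.
Proof.
move=> rd yp; apply/setP => z; rewrite !inE; apply: eq_connect_from => w yw.
apply: ready_heard_from => //; apply: (fintype.subsetP (ancestors_trans yp)).
by rewrite inE.
Qed.

Lemma decided_at t p v : output (st t p) = Some v ->
  exists t', decision (H t' p) p = Some v.
Proof.
elim: t => [|t IH]; first by have [outp _ _] := run_initial r p; rewrite /st outp.
have [pt|pt] := eqVneq p (actor r t); last by rewrite st_idle.
(* The decision uses the messages just received, that is, the knowledge at [t.+1]. *)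
have dE : H t.+1 p = receive (st t p) (received r t) by rewrite /H pt st_step.
rewrite {1}pt st_step /= -pt; case: (output _) IH => [w|_]; first exact.
by rewrite -dE => ?; exists t.+1.
Qed.

Definition minimal_sources : {set {set 'I_n}} :=
  [set sources q | q : 'I_n & viewed q &&
    [forall z in sources q, #|sources q| <= #|sources z|]]%SET.

(** Above a ready process the known and true graphs agree, and ancestors of ancestors are ancestors;
    so a set that is minimal locally is minimal in the whole run. *)
Lemma decides_minimal p v : decides r p v -> exists B c,
  [/\ B \in minimal_sources, [pick c in B] = Some c & v = x c].
Proof.
move=> [t0 /decided_at[t /decisionP[rd [q [c [qp qmin cq cv]]]]]].
have qE := ready_ancestors rd qp; exists (sources q), c.
have [vE _ _] := knows_genuine cv; rewrite -{2}qE; split=> //.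
apply: imset_f; rewrite inE; apply/andP; split.
  by have /existsP[v' /knows_genuine[]] := forall_inP rd q qp.
apply/forall_inP => z; rewrite -qE => zq.
have zp : z \in ancestors (H t p) p by apply: (fintype.subsetP (ancestors_trans qp)).
by rewrite -(ready_ancestors rd zp) qmin.
Qed.

Lemma protocol_validity : validity r.
Proof. by move=> p v /decides_minimal[_ [c [_ _ ->]]]; exists c. Qed.

Lemma protocol_agreement k : n < k.+1 * m -> k_agreement k r.
Proof.
move=> nk; have minS : #|minimal_sources| <= k.
  apply: (@card_minimal_sets _ sources viewed m); last by rewrite card_ord.
  - by move=> q; rewrite inE connect0.
  - move=> q z; rewrite inE => qz; apply/fintype.subsetP => w; rewrite !inE.
    exact: connect_trans.
  (* The view of [q] consists of successors of [q], so [sources q] has at least [m] elements. *)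
  move=> q /asboolP[t [S tS]]; have [mS _] := view_spec tS.
  apply: (leq_trans mS); apply/subset_leq_card/fintype.subsetP => z zS.
  by rewrite inE; apply/connect1/asboolP; exists t, S.
(* Wrapped in [Some], every decided value is the image of a minimal set [B] under [omap x
   [pick c in B]]. *)
apply: leq_trans minS; rewrite /k_agreement -(card_imset _ (fun v w : V => @Some_inj _ v w)).
apply: leq_trans (leq_imset_card (fun B : {set 'I_n} => omap x [pick c in B]) _).
apply/subset_leq_card/fintype.subsetP => _ /imsetP[v + ->].
rewrite inE => /asboolP[p /decides_minimal[B [c [Bm Bc ->]]]].
by apply/imsetP; exists B => //; rewrite Bc.
Qed.

(** * Termination of the protocol *)

Section Liveness.
Variable f : nat.
Hypotheses (adm : admissible f r) (mf : m + f <= n).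

(** Every process sends forever, so some message sent no earlier than [t0] arrives; taking [t0] past
    the fixing of a view ensures that this view is announced. *)
Lemma announced p q t0 : correct r p -> correct r q -> exists T, forall t, T <= t ->
  exists2 w, t0 <= w & (q, x q, W w q) \in H t p.
Proof.
have [_ live deliver] := adm => cp cq.
have [w t0w qw] := live q cq t0.
have [|t' [wt' pt' mt']] := deliver p cp w (q, x q, W w q).
  by rewrite /sent /= /protocol_send /= qw -(input_const w q).
exists t'.+1 => t lt; exists w => //; apply: fintype.subsetP (heard_mono p lt) _ _.
by rewrite /H -pt' st_step !inE; apply/orP; right; apply/asboolP.
Qed.

Lemma step_after p T : correct r p -> exists2 t, T <= t & actor r t = p.
Proof. by have [_ live _] := adm => cp; apply: live. Qed.

Lemma correct_viewed p : correct r p -> exists t S, W t p = Some S.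
Proof.
move=> cp.
have [T hT] : exists T, forall t q, T <= t -> correct r q -> q \in senders (H t p).
  apply: eventually_forall => q; have [cq|ncq] := pselect (correct r q); last by exists 0.
  have [T hT] := announced 0 cp cq; exists T => t /hT[w _ qw] _.
  by apply/imsetP; exists (q, x q, W w q).
(* The view of [p] is only updated when [p] itself steps. *)
have [t Tt tp] := step_after T cp; exists t.+1.
have ms : m <= #|senders (H t.+1 p)|.
  have [dead _ _] := adm.
  (* At least [n - f], hence at least [m], processes are correct, and all of them have been
     heard. *)
  apply: (@leq_trans #|(~: initially_dead r)%SET|).
    rewrite -(leq_add2l #|initially_dead r|) cardsC card_ord.
    by apply: leq_trans mf; rewrite addnC leq_add2l.
  apply/subset_leq_card/fintype.subsetP => q; rewrite inE => cq.
  by apply: hT => //; apply: leqW.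
move: ms; rewrite /H /W -{1 2}tp st_step /=.
case: (view _) => [B _|-> /=]; [by exists B|by eexists].
Qed.

Lemma protocol_termination : termination r.
Proof.
move=> p cp.
have [T hT] : exists T, forall t q, T <= t -> correct r q -> exists v, knows (H t p) q v.
  apply: eventually_forall => q; have [cq|ncq] := pselect (correct r q); last by exists 0.
  have [t0 [S tS]] := correct_viewed cq.
  have [T hT] := announced t0 cp cq; exists T => t /hT[w t0w qw] _.
  by exists (x q); apply/existsP; exists S; rewrite -(view_stable t0w tS).
have [t Tt tp] := step_after T cp.
(* Views contain only senders, which are correct; so all ancestors of [p] are correct, and their
   views are known by now. *)
have correct_path s q : correct r q ->
    path (heard_from (H t.+1 p)) q s -> correct r (last q s).
  elim: s q => //= y s IH q cq /andP[+ ys]; move=> /existsP[v /existsP[S /andP[qS yS]]].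
  have [_ _ /(_ S erefl)[w wS]] := (all_genuine t.+1 p).2 _ qS.
  by apply: IH ys; have [_] := view_spec wS; apply.
have rd : ready (H t.+1 p) p.
  apply/forall_inP => z; rewrite inE => /connectP[s ps ->].
  by apply/existsP; apply: hT; [exact: leqW|exact: correct_path].
case ov: (output (st t.+1 p)) => [v|]; first by exists v, t.+1.
move: ov (ready_decision rd); have stE := st_step t; rewrite tp in stE; rewrite /H stE /=.
by case: (output _) => // ->.
Qed.

End Liveness.

End ProtocolRun.
End Protocol.

(** * The two directions and the arithmetic *)

Lemma solvable_of_quorums n f k (V : finType) :
  n < k.+1 * (n - f) -> set_agreement_solvable n f k V.
Proof.
move=> nk; exists (protocol n V (n - f)) => r adm; split.
- exact: protocol_agreement nk.
- exact: protocol_validity.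
apply: protocol_termination adm _; rewrite subnK//; apply: ltnW.
by rewrite -subn_gt0; move: nk; case: (n - f) => //; rewrite muln0.
Qed.

Lemma unsolvable_of_groups n f k (V : finType) :
  n <= #|V| -> f < n -> k.+1 * (n - f) <= n -> ~ set_agreement_solvable n f k V.
Proof.
move=> nV fn kn [A].
have m0 : 0 < n - f by rewrite subn_gt0.
(* The groups are consecutive blocks of [n - f] ids; all [k.+1] blocks fit by [kn]. *)
pose G (i : 'I_k.+1) : {set 'I_n} := [set p : 'I_n | p %/ (n - f) == i]%SET.
have ltG (i : 'I_k.+1) (j : 'I_(n - f)) : i * (n - f) + j < n.
  apply: leq_trans kn; apply: (@leq_trans (i.+1 * (n - f))).
    by rewrite mulSn addnC ltn_add2r.
  by rewrite leq_mul2r ltn_ord orbT.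
pose g i j : 'I_n := Ordinal (ltG i j).
have gG i j : g i j \in G i by rewrite inE /= divnMDl// divn_small// addn0.
pose x (p : 'I_n) : V := enum_val (widen_ord nV p).
apply: (@too_many_groups _ _ _ _ _ x G).
- by move=> p q /enum_val_inj /(congr1 val) /= /val_inj.
- by move=> i j p; rewrite !inE => /eqP pi /eqP pj; apply: val_inj; rewrite /= -pi.
move=> i; split; first by exists (g i (Ordinal m0)).
have g_inj : injective (g i) by move=> j j' /(congr1 val) /= /addnI /val_inj.
rewrite -leq_subLR -[n - f]card_ord -(card_imset _ g_inj).
by apply/subset_leq_card/fintype.subsetP => _ /imsetP[j _ ->].
Qed.

Theorem theorem8 (n f k : nat) (V : finType)
    (hV : (n <= #|V|)%N) (hf : (f < n)%N) (hk : (1 <= k)%N) :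
  (set_agreement_solvable n f k V <-> (k * n > (k + 1) * f)%N) /\
  ((k * n > (k + 1) * f)%N <->
   (k%:R > f%:R / (n%:R - f%:R) :> rat)%R).
Proof.
(* Add [k.+1 * f] to both sides and cancel [n]. *)
have quorum : (n < k.+1 * (n - f)) = ((k + 1) * f < k * n).
  rewrite addn1 mulnBr -(ltn_add2r (k.+1 * f)) subnK; last first.
    by rewrite leq_mul2l ltnW.
  by rewrite mulSn ltn_add2l.
have ratio : (f%:R / (n%:R - f%:R) < k%:R :> rat)%R = ((k + 1) * f < k * n).
  by rewrite -natrB ?(ltnW hf)// ltr_pdivrMr ?ltr0n ?subn_gt0// -natrM ltr_nat
    mulnBr addn1 mulSn ltn_subRL addnC.
rewrite ratio; split=> //; rewrite -quorum; split; last exact: solvable_of_quorums.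
move=> sol; rewrite ltnNge; apply/negP => kn.
exact: unsolvable_of_groups hV hf kn sol.
Qed.
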